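(* There is an absolute constant $c>0$ such that the following holds. For every real $0<\alpha<1$, every integer $t\ge 2$ and every infinite sequence $\mathcal{A}$ of positive integers with $d^{*}(\mathcal{A})>\alpha$, writing $\mathcal{B}=\mathcal{A}\cdot\mathcal{A}=\{b_1<b_2<\cdots\}$, we have $b_{n+t}-b_n\le c\,t^2\alpha^{-4}$ for infinitely many $n$.
   Context: For an infinite set $\mathcal{A}$ of positive integers, the upper Banach density is $d^{*}(\mathcal{A})=\limsup_{|I|\to\infty}\frac{|\mathcal{A}\cap I|}{|I|}$, where $I$ runs through all intervals of integers. The product set $\mathcal{A}\cdot\mathcal{A}$ is the set of all products $a_ia_j$ with $a_i,a_j\in\mathcal{A}$, and $b_1<b_2<\cdots$ denotes its elements in increasing order. *)

(* Defs.v *)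
From HB Require Import structures.
From mathcomp Require Import all_boot all_order all_algebra.
From mathcomp Require Import finmap.
From mathcomp Require Import all_classical all_reals all_analysis.

Set Implicit Arguments.
Unset Strict Implicit.
Unset Printing Implicit Defensive.

Import Order.TTheory GRing.Theory Num.Theory.

Local Open Scope classical_set_scope.
Local Open Scope ring_scope.

(* A pair I = (m, N) encodes the interval of integers {m, m+1, ..., m+N-1},
   so that |I| = I.2. *)
Definition zinterval (I : int * nat) : set int :=
  [set k : int | I.1 <= k < I.1 + I.2%:Z].

Lemma finite_zinterval (I : int * nat) : finite_set (zinterval I).
Proof.
apply: (@sub_finite_set _ _ [set I.1 + i%:Z | i in `I_I.2]); last first.
  exact/finite_image/finite_II.
move=> k /= /andP[Ik kI]; exists `|k - I.1|%N.
  by rewrite -ltz_nat gez0_abs ?subr_ge0// ltrBlDl.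
by rewrite gez0_abs ?subr_ge0// [LHS]addrC subrK.
Qed.

Definition interval_density (R : realType) (A : set nat) (I : int * nat) : R :=
  #|` fset_set (Posz @` A `&` zinterval I) |%:R / I.2%:R.

(* The limsup as |I| -> oo, i.e. the infimum over N of the supremum over all
   intervals with |I| >= N; spelled out rather than stated with limf_esup
   because int * nat carries no filteredType structure. *)
Definition upper_banach_density (R : realType) (A : set nat) : \bar R :=
  ereal_inf [set ereal_sup [set (interval_density R A I)%:E
                           | I in [set I : int * nat | (N <= I.2)%N]]
            | N in [set: nat]].

Definition product_set (A : set nat) : set nat :=
  [set (x * y)%N | x in A & y in A].

Definition increasing_enumeration (b : nat -> nat) (B : set nat) : Prop :=
  increasing_seq b /\ range b = B.

(* Main.v *)
(* Cut the integers into blocks of length L, of order t / alpha^2.  Arbitrarily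
   far out there is a block [x, x + L) containing at least alpha L / 2 elements
   of A.  By pigeonhole, more than t pairs (x + i, x + j) of elements of A in
   this block share the same value of i + j.  Their products
   x^2 + (i + j) x + i j are distinct and differ only in the last term, hence
   lie within L^2 = O(t^2 / alpha^4) of each other. *)

Require Import Defs.
From HB Require Import structures.
From mathcomp Require Import all_boot all_order all_algebra.
From mathcomp Require Import finmap.
From mathcomp Require Import all_classical all_reals all_analysis.
From mathcomp Require Import zify ring lra.

Set Implicit Arguments.
Unset Strict Implicit.
Unset Printing Implicit Defensive.

Import Order.TTheory GRing.Theory Num.Theory.

Local Open Scope classical_set_scope.
Local Open Scope ring_scope.

Lemma card_fibers (T U : finType) (f : T -> U) (D : {set T}) :
  (#|D| = \sum_u #|[set x in D | f x == u]|)%N.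
Proof.
rewrite -sum1_card (partition_big f predT)//=; apply: eq_bigr => u _.
by rewrite -sum1_card; apply: eq_bigl => x; rewrite !inE.
Qed.

Lemma large_fiber (T U : finType) (f : T -> U) (D : {set T}) (t : nat) :
  (#|U| * t < #|D|)%N -> exists u, (t < #|[set x in D | f x == u]|)%N.
Proof.
move=> ltD; apply/existsP; apply: contraTT ltD => /existsPn small.
rewrite -leqNgt (card_fibers f) -sum_nat_const.
by apply: leq_sum => u _; rewrite leqNgt.
Qed.

Definition block (A : set nat) (L k : nat) : {set 'I_L} :=
  [set i : 'I_L | (k * L + i)%N \in A]%SET.

(** Equal sum and product make both pairs the roots of one quadratic, so they agree up to a swap,
    which the order condition excludes. *)
Lemma sum_mul_inj (a a' c c' : nat) :
  (a + a' = c + c')%N -> (a * a' = c * c')%N ->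
  (a <= a')%N = (c <= c')%N -> a = c /\ a' = c'.
Proof.
move=> sumE mulE leE.
have : ((a%:Z - c%:Z) * (a'%:Z - c%:Z) = 0) by nia.
move/eqP; rewrite mulf_eq0 => /orP[] /eqP; lia.
Qed.

(* With L offsets there are at most 2L values of the sum of two of them; a pair
   is determined by its sum, its product and the order of its entries, hence
   the 4L pigeonholes. *)
Lemma block_products (A : set nat) (L k t : nat) :
  (4 * L * t < #|block A L k| ^ 2)%N ->
  exists s : seq nat, [/\ uniq s, (t < size s)%N,
    forall p, p \in s -> product_set A p /\ ((k * L) ^ 2 <= p)%N &
    forall p q, p \in s -> q \in s -> (p <= q + L ^ 2)%N].
Proof.
set S := block A L k => ltS.
have sum_lt (u : 'I_L * 'I_L) : (u.1 + u.2 < L + L)%N.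
  by case: u => i j /=; have := ltn_ord i; have := ltn_ord j; lia.
pose f u := (Ordinal (sum_lt u), (u.1 <= u.2)%N).
have [|v ltF] := @large_fiber _ _ f (finset.setX S S) t.
  rewrite cardsX card_prod card_ord card_bool mulnn.
  by apply: leq_ltn_trans ltS; rewrite addnn -!muln2; lia.
set F := [set x in _ | _]%SET in ltF.
pose g (u : 'I_L * 'I_L) := ((k * L + u.1) * (k * L + u.2))%N.
have gE u : g u = ((k * L) ^ 2 + k * L * (u.1 + u.2) + u.1 * u.2)%N.
  by rewrite /g -mulnn; lia.
have Fsum u w : u \in F -> w \in F ->
    (u.1 + u.2 = w.1 + w.2)%N /\ (u.1 <= u.2)%N = (w.1 <= w.2)%N.
  rewrite !inE => /andP[_ /eqP uv] /andP[_ /eqP]; rewrite -uv => -[-> ->].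
  by [].
exists [seq g u | u <- enum F]; split.
- rewrite map_inj_in_uniq ?enum_uniq// => u w; rewrite !mem_enum => uF wF guw.
  have [sumE leE] := Fsum _ _ uF wF.
  have mulE : (u.1 * u.2 = w.1 * w.2)%N by move: guw; rewrite !gE sumE => /addnI.
  have [] := sum_mul_inj sumE mulE leE.
  by case: u {uF sumE leE guw mulE} => u1 u2; case: w {wF} => w1 w2 /=
    => /val_inj-> /val_inj->.
- by rewrite size_map -cardE.
- move=> _ /mapP[u uF ->]; rewrite mem_enum !inE in uF.
  case/andP: uF => /andP[]; rewrite !inE => u1 u2 _; split.
    by exists (k * L + u.1)%N => //; exists (k * L + u.2)%N.
  by rewrite /g -mulnn leq_mul ?leq_addr.
- move=> _ _ /mapP[u + ->] /mapP[w + ->]; rewrite !mem_enum => uF wF.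
  have [sumE _] := Fsum _ _ uF wF.
  rewrite !gE sumE -[leqRHS]addnA leq_add2l.
  rewrite (leq_trans _ (leq_addl _ _))// -(mulnn L).
  by rewrite leq_mul// ltnW.
Qed.

(** The interval is covered by [I.2 %/ L + 2] consecutive blocks. Those of index below [K] may be
    full and cost at most [K * L] together; each of the others costs at most [h]. *)
Lemma card_zinterval_blocks (A : set nat) (L K h : nat) (I : int * nat) :
  (0 < L)%N -> (forall k, (K <= k)%N -> (#|block A L k| <= h)%N) ->
  (#|` fset_set (Posz @` A `&` zinterval I) | <= K * L + (I.2 %/ L + 2) * h)%N.
Proof.
(* [A] has no negative elements, so the left endpoint may be raised to 0; [q] is the index of the
   block containing it. *)
move=> L0 small; pose p := absz (Num.max 0 I.1); pose q := (p %/ L)%N.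
set Q := (I.2 %/ L + 2)%N.
pose D := [set u : 'I_Q * 'I_L | ((q + u.1) * L + u.2)%N \in A]%SET.
have leD : (#|D| <= K * L + Q * h)%N.
  rewrite (card_fibers fst).
  have fiberE (j : 'I_Q) : #|[set u in D | u.1 == j]%SET| = #|block A L (q + j)|.
    rewrite -(card_imset (block A L (q + j)) (f := pair j)); last by move=> ? ? [].
    apply: eq_card => -[j' i]; rewrite !inE/=; apply/andP/imsetP.
      by rewrite inE => -[Ai /eqP <-]; exists i; rewrite ?inE.
    by move=> [i' Ai [-> ->]]; rewrite inE in Ai; rewrite eqxx.
  under eq_bigr do rewrite fiberE.
  apply: (@leq_trans (\sum_(j < Q) ((if (j < K)%N then L else 0) + h))%N).
    apply: leq_sum => j _; case: ltnP => jK.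
      by rewrite (leq_trans (max_card _))// card_ord leq_addr.
    by rewrite add0n small// (leq_trans jK)// leq_addl.
  rewrite big_split/= sum_nat_const card_ord leq_add2r.
  suff -> : (\sum_(j < Q) (if (j < K)%N then L else 0) = minn Q K * L)%N.
    by rewrite leq_mul2r geq_minr orbT.
  elim: Q {D fiberE} => [|n IHn]; first by rewrite big_ord0 min0n.
  rewrite big_ord_recr/= IHn; case: ltnP => nK.
    by rewrite (minn_idPl nK) mulSnr.
  by rewrite (minn_idPr (leqW nK)) addn0.
apply: leq_trans leD.
set X := fset_set _.
have Xfin : finite_set (Posz @` A `&` zinterval I).
  by apply: finite_setIr; exact: finite_zinterval.
rewrite cardE -(size_map (fun u : 'I_Q * 'I_L => ((q + u.1) * L + u.2)%N%:Z)).
apply: uniq_leq_size => [|x]; first exact: fset_uniq.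
rewrite in_fset_set// inE => -[[a Aa <-{x}] /= /andP[Ia aI]].
have qa : (q <= a %/ L)%N by rewrite leq_div2r//; lia.
have aQ : (a %/ L - q < Q)%N.
  (* The remainders of [p] and [I.2] modulo [L] add up to less than [2 * L], so the quotient of [a]
     exceeds [q] by at most [I.2 %/ L + 1]; hence the 2 in [Q]. *)
  have := divn_eq a L; have := divn_eq p L; have := divn_eq I.2 L.
  have := ltn_pmod a L0; have := ltn_pmod p L0; have := ltn_pmod I.2 L0.
  rewrite /Q -/q; nia.
apply/mapP; exists (Ordinal aQ, Ordinal (ltn_pmod a L0)) => /=; last first.
  by rewrite subnKC// -divn_eq.
by rewrite mem_enum inE/= subnKC// -divn_eq inE.
Qed.

(** Let [n] be the least index of an element of [s]. More than [t] distinct indices cannot fit into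
    [[n, n + t)], so some element of [s] has index at least [n + t], and it bounds [b (n + t)]. *)
Lemma enumeration_gap (b : nat -> nat) (B : set nat) (s : seq nat) (t w : nat) :
  increasing_enumeration b B -> uniq s -> (t < size s)%N ->
  (forall p, p \in s -> B p) ->
  (forall p q, p \in s -> q \in s -> (p <= q + w)%N) ->
  exists2 n, b n \in s & (b (n + t) <= b n + w)%N.
Proof.
move=> [bmono bB] us ts sB sw.
have /choice[g gP] : forall p, exists n, p \in s -> b n = p.
  move=> p; case: (boolP (p \in s)) => ps; last by exists 0%N.
  by have := sB _ ps; rewrite -bB => -[n _ <-]; exists n.
have exn : exists n, n \in map g s.
  by case: s ts {us sB sw gP} => // p s _; exists (g p); rewrite inE eqxx.
case: (ex_minnP exn) => n /mapP[p ps np] nmin.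
have bn : b n = p by rewrite np gP.
exists n; first by rewrite bn.
have [/hasP[q qs nq]|/hasPn far] := boolP (has (fun q => (n + t <= g q)%N) s).
  by apply: (@leq_trans (b (g q))); [rewrite -leEnat bmono|rewrite gP// bn sw].
suff : (size s <= t)%N by rewrite leqNgt ts.
rewrite -(size_map g) -(size_iota n t); apply: uniq_leq_size.
  by rewrite map_inj_in_uniq// => x y xs ys gxy; rewrite -(gP x)// gxy gP.
move=> _ /mapP[q qs ->]; rewrite mem_iota nmin ?map_f//=.
by rewrite ltnNge far.
Qed.

(** Otherwise an interval of length N holds at most K L + (N / L + 2) alpha L / 2 = alpha N / 2 + K
    L + alpha L elements of [A], which is below alpha N once N is large. *)
Lemma dense_block (R : realType) (A : set nat) (alpha : R) (L K : nat) :
  0 < alpha -> (0 < L)%N -> (alpha%:E < upper_banach_density R A)%E ->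
  exists2 k, (K <= k)%N & alpha * L%:R / 2 < #|block A L k|%:R.
Proof.
move=> a0 L0 dA; apply: contrapT => none.
have a2 : 0 <= alpha * L%:R / 2 by rewrite divr_ge0 ?mulr_ge0// ltW.
pose h := Num.trunc (alpha * L%:R / 2).
have small k : (K <= k)%N -> (#|block A L k| <= h)%N.
  by move=> Kk; rewrite truncn_ge_nat// leNgt; apply/negP => ?; apply: none; exists k.
(* Any length above 2 K L / alpha + 2 L makes the error K L + alpha L less than half of alpha times
   the length. *)
pose N := (Num.trunc (2 * (K * L + L)%:R / alpha + 2 * L%:R)).+1.
have : (alpha%:E < ereal_sup [set (interval_density R A I)%:E
                           | I in [set I : int * nat | (N <= I.2)%N]])%E.
  by apply: lt_le_trans dA _; apply: ereal_inf_lbound; exists N.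
move=> /ereal_sup_gt[_ [I /= NI <-]]; rewrite lte_fin /interval_density.
have I0 : 0 < I.2%:R :> R by rewrite ltr0n; apply: leq_trans NI.
rewrite ltr_pdivlMr// => dI.
have := card_zinterval_blocks I L0 small.
rewrite -(ler_nat R) natrD !natrM natrD => cI.
have hL : h%:R <= alpha * L%:R / 2 by rewrite truncn_le.
have LR : 0 < L%:R :> R by rewrite ltr0n.
have divL : (I.2 %/ L)%:R <= I.2%:R / L%:R :> R.
  by rewrite ler_pdivlMr// -natrM ler_nat leq_trunc_div.
have IN : 2 * (K * L + L)%:R / alpha + 2 * L%:R < I.2%:R.
  by apply: lt_le_trans (truncnS_gt _) _; rewrite ler_nat.
have : (I.2 %/ L)%:R * h%:R <= alpha * I.2%:R / 2.
  apply: (@le_trans _ _ (I.2%:R / L%:R * (alpha * L%:R / 2))).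
    by rewrite ler_pM.
  by rewrite le_eqVlt; apply/orP; left; apply/eqP; field; rewrite gt_eqF.
move: IN; rewrite -ltrBrDr ltr_pdivrMr// natrD natrM.
nra.
Qed.

Lemma infinite_nat_unbounded (S : set nat) :
  (forall m, exists2 n, (m < n)%N & S n) -> infinite_set S.
Proof.
move=> unb /finite_seqP[s Ss].
have [n ltn] := unb (\max_(i <- s) i)%N.
rewrite Ss /= => ns; move: ltn; rewrite ltnNge => /negP; apply.
exact: leq_bigmax_seq.
Qed.

Theorem theorem3 (R : realType) :
  exists c : R, 0 < c /\
    forall (alpha : R) (t : nat) (A : set nat) (b : nat -> nat),
      0 < alpha -> alpha < 1 -> (2 <= t)%N ->
      infinite_set A -> A `<=` [set n | (0 < n)%N] ->
      (alpha%:E < upper_banach_density R A)%E ->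
      increasing_enumeration b (product_set A) ->
      infinite_set [set n : nat |
        (b (n + t)%N)%:R - (b n)%:R <= c * t%:R ^+ 2 * alpha ^- 4].
Proof.
exists (17 ^+ 2); split=> [|alpha t A b a0 a1 t2 _ _ dA bA]; first by rewrite exprn_gt0.
have tR : 2 <= t%:R :> R by rewrite ler_nat.
pose y : R := t%:R / alpha ^+ 2.
have a20 : 0 < alpha ^+ 2 by rewrite exprn_gt0.
have ya : y * alpha ^+ 2 = t%:R by rewrite divfK// gt_eqF.
have y1 : 1 <= y by rewrite ler_pdivlMr// mul1r; nra.
(* The pigeonhole needs 4 L t < (alpha L / 2)^2 up to equality, that is L >= 16 y. Rounding up costs
   at most 1 <= y, so L <= 17 y, whence the constant 17^2. *)
pose L := (Num.trunc (16 * y)).+1.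
have L0 : (0 < L)%N by [].
have Lgt : 16 * y < L%:R by exact: truncnS_gt.
have Lle : L%:R <= 17 * y.
  have : (Num.trunc (16 * y))%:R <= 16 * y by rewrite truncn_le//; lra.
  by rewrite /L -natr1; lra.
apply: infinite_nat_unbounded => m.
(* Products from block [k] are at least (k L)^2 >= k > [b m], which forces their indices beyond
   [m]. *)
have [k mk blk] := dense_block (b m).+1 a0 L0 dA.
have [|s [us ts sB sw]] := @block_products A L k t.
  rewrite -(ltr_nat R) natrX !natrM.
  have : (alpha * L%:R / 2) ^+ 2 < #|block A L k|%:R ^+ 2 :> R.
    by rewrite ltrXn2r// divr_ge0// mulr_ge0// ltW.
  apply: le_lt_trans; rewrite -ya.
  have -> : (alpha * L%:R / 2) ^+ 2 = alpha ^+ 2 * (L%:R * L%:R) / 4 by field.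
  have : 0 <= alpha ^+ 2 * (L%:R * (L%:R - 16 * y)).
    by rewrite !mulr_ge0// ?subr_ge0 ltW.
  by lra.
have [n bns bnt] := enumeration_gap bA us ts (fun p ps => (sB p ps).1) sw.
exists n => /=.
  have [_ kn] := sB _ bns; have [bmono _] := bA.
  rewrite ltnNge -bmono leEnat -ltnNge (leq_trans mk)//.
  by apply: leq_trans kn; nia.
have -> : 17 ^+ 2 * t%:R ^+ 2 * alpha ^- 4 = (17 * y) ^+ 2.
  by rewrite /y; field; rewrite gt_eqF.
apply: (@le_trans _ _ (L%:R ^+ 2)); last by rewrite lerXn2r// nnegrE; lra.
by rewrite lerBlDl -natrX -natrD ler_nat.
Qed.
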